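(* Let $\Lambda\colon L\times W\to[0,\infty]$ be a dissimilarity, let $\alpha\colon[0,\infty)\to[0,\infty)$ be a translation function and let $T\colon L\to[0,\infty]$ be an $\alpha$-truncation function for $\Lambda$. Let $\Gamma$ be the $T$-truncation of $\Lambda$. Then, in the homotopy category of topological spaces, the inclusion $N\Gamma\to N\Lambda$ of the nerve of $\Gamma$ in the nerve of $\Lambda$ is an $\alpha$-interleaving.
   Context: A translation function is an order preserving function $\alpha\colon[0,\infty)\to[0,\infty)$ with $t\le\alpha(t)$ for all $t$; by convention $\alpha(\infty)=\infty$. A dissimilarity $\Lambda$ consists of two sets $L$ and $W$ and a function $\Lambda\colon L\times W\to[0,\infty]$ (no further axioms). For $t\in[0,\infty]$, $N\Lambda_t$ is the simplicial complex consisting of all finite $\sigma\subseteq L$ for which there exists $w\in W$ with $\Lambda(l,w)<t$ for all $l\in\sigma$. The Dowker nerve $N\Lambda$ is the filtered simplicial complex $t\mapsto N\Lambda_t$, with inclusions as structure maps; via geometric realization it is regarded as a filtered object in the homotopy category of topological spaces. A function $T\colon L\to[0,\infty]$ is an $\alpha$-truncation function for $\Lambda$ if for all $t\in[0,\infty]$ and all $l\in L$ there exists $l'\in L$ so that for all $w\in W$ with $\Lambda(l,w)<t$ we have $\Lambda(l',w)<\alpha(t)$ and $\Lambda(l',w)<T(l')$. The $T$-truncation of $\Lambda$ is the dissimilarity $\Gamma\colon L\times W\to[0,\infty]$ with $\Gamma(l,w)=\Lambda(l,w)$ if $\Lambda(l,w)<T(l)$ and $\Gamma(l,w)=\infty$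 otherwise. A filtered object in a category $\mathcal C$ is a functor $C\colon[0,\infty]\to\mathcal C$, where $[0,\infty]$ is the category with a unique morphism $s\to t$ if and only if $s\le t$; morphisms of filtered objects are natural transformations. The $\alpha$-unit of $C$ has components $\alpha_{*C}(t)=C(t\to\alpha(t))\colon C(t)\to C(\alpha(t))$. A morphism $G\colon C\to C'$ of filtered objects is an $\alpha$-interleaving if for every $t\in[0,\infty]$ there exists a morphism $F_t\colon C'(t)\to C(\alpha(t))$ in $\mathcal C$ such that $\alpha_{*C}(t)=F_t\circ G(t)$ and $\alpha_{*C'}(t)=G(\alpha(t))\circ F_t$ (no naturality of $F_t$ in $t$ is required). *)

(* Defs.v *)
From HB Require Import structures.
From mathcomp Require Import all_boot all_order all_algebra generic_quotient.
From mathcomp Require Import all_classical all_reals.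
From mathcomp Require Import interval_inference topology normedtype.
From mathcomp Require Import lra.

Set Implicit Arguments.
Unset Strict Implicit.
Unset Printing Implicit Defensive.
Import Order.TTheory GRing.Theory Num.Theory.
Import numFieldNormedType.Exports.
Local Open Scope classical_set_scope.
Local Open Scope ring_scope.
Local Open Scope quotient_scope.

(** * Categories, functors, natural transformations *)

Record category := Category {
  obj :> Type;
  hom : obj -> obj -> Type;
  idm : forall a, hom a a;
  comp : forall a b c, hom b c -> hom a b -> hom a c;
  comp1m : forall a b (f : hom a b), comp (idm b) f = f;
  compm1 : forall a b (f : hom a b), comp f (idm a) = f;
  compA : forall a b c d (h : hom c d) (g : hom b c) (f : hom a b),
    comp h (comp g f) = comp (comp h g) f
}.
Arguments idm {c0} a : rename.
Arguments comp {c0 a b c} g f : rename.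

Record functor (C D : category) := Functor {
  fobj :> C -> D;
  fmap : forall a b, hom a b -> hom (fobj a) (fobj b);
  fmap_id : forall a, fmap (idm a) = idm (fobj a);
  fmap_comp : forall a b c (g : hom b c) (f : hom a b),
    fmap (comp g f) = comp (fmap g) (fmap f)
}.
Arguments fmap {C D} f {a b} u : rename.

Record nattrans (C D : category) (F G : functor C D) := NatTrans {
  ntapp :> forall a, hom (F a) (G a);
  nattransP : forall a b (u : hom a b),
    comp (ntapp b) (fmap F u) = comp (fmap G u) (ntapp a)
}.

Section comp_functor.
Variables (C D E : category).

Fact comp_functor_id (G : functor D E) (F : functor C D) (a : C) :
  fmap G (fmap F (idm a)) = idm (G (F a)).
Proof. by rewrite fmap_id fmap_id. Qed.

Fact comp_functor_comp (G : functor D E) (F : functor C D) (a b c : C)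
    (g : hom b c) (f : hom a b) :
  fmap G (fmap F (comp g f)) = comp (fmap G (fmap F g)) (fmap G (fmap F f)).
Proof. by rewrite fmap_comp fmap_comp. Qed.

Definition comp_functor (G : functor D E) (F : functor C D) : functor C E :=
  @Functor C E (fun a => G (F a)) (fun a b u => fmap G (fmap F u))
    (comp_functor_id G F) (comp_functor_comp G F).

Fact whisker_natural (G : functor D E) (F F' : functor C D)
    (u : nattrans F F') (a b : C) (v : hom a b) :
  comp (fmap G (u b)) (fmap (comp_functor G F) v) =
  comp (fmap (comp_functor G F') v) (fmap G (u a)).
Proof. by rewrite /= -!fmap_comp nattransP. Qed.

Definition whisker (G : functor D E) (F F' : functor C D) (u : nattrans F F') :
    nattrans (comp_functor G F) (comp_functor G F') :=
  @NatTrans C E (comp_functor G F) (comp_functor G F')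
    (fun a => fmap G (u a)) (whisker_natural G u).

End comp_functor.

Section thin_category.
Variables (T : Type) (le : T -> T -> Prop).
Hypotheses (le_refl : forall a, le a a)
  (le_tr : forall b a c, le a b -> le b c -> le a c).

Definition thin_category : category :=
  @Category T le le_refl (fun a b c g f => le_tr f g)
    (fun _ _ _ => Prop_irrelevance _ _) (fun _ _ _ => Prop_irrelevance _ _)
    (fun _ _ _ _ _ _ _ => Prop_irrelevance _ _).

Lemma thin_irrelevance (a b : thin_category) (f g : hom a b) : f = g.
Proof. exact: (@Prop_irrelevance (le a b)). Qed.

End thin_category.

(** * Filtered objects and interleavings *)

Definition poset_category d (T : porderType d) : category :=
  @thin_category T (fun s t => (s <= t)%O) (@lexx d T) (@le_trans d T).

Notation extnonneg_category R := (poset_category {nonneg \bar R}).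

Definition filtered (R : realType) (C : category) :=
  functor (extnonneg_category R) C.

Record translation (R : realType) := Translation {
  translation_fun :> {nonneg R} -> {nonneg R};
  translation_homo : {homo translation_fun : s t / (s <= t)%O};
  translation_ge : forall t, (t <= translation_fun t)%O
}.

Section translation_ext.
Context {R : realType}.
Implicit Types (alpha : {nonneg R} -> {nonneg R}) (t : {nonneg \bar R}).

(* The extension by +oo |-> +oo; the case of -oo does not arise. *)
Definition translation_ext alpha t : {nonneg \bar R} :=
  match t%:num%E as x return (0 <= x)%E -> {nonneg \bar R} with
  | r%:E => fun r0 => ((alpha (NngNum (r0 : 0 <= r)))%:num%:E)%:nng%E
  | _ => fun=> (+oo%:nng)%E
  end (ge0e t).

Lemma translation_ext_fin alpha (r : {nonneg R}) :
  (translation_ext alpha (r%:num%:E)%:nng%E)%:num%E = (alpha r)%:num%:E.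
Proof.
rewrite /translation_ext /=; congr (alpha _)%:num%:E.
exact: val_inj.
Qed.

Lemma translation_ext_pinfty alpha :
  (translation_ext alpha (+oo%:nng)%E)%:num%E = +oo%E.
Proof. by []. Qed.

Lemma translation_ext_ge (alpha : translation R) t :
  (t <= translation_ext alpha t)%O.
Proof.
rewrite -[(_ <= _)%O]/((t%:num <= (translation_ext alpha t)%:num)%E).
rewrite /translation_ext; move: (ge0e t); case: (t%:num%E) => [r||] r0 /=.
- exact: (translation_ge alpha (NngNum (r0 : 0 <= r))).
- by rewrite leey.
- by rewrite leNye.
Qed.

End translation_ext.

Section interleaving.
Context {R : realType} {C : category}.
Implicit Types (alpha : translation R) (X Y : filtered R C).

Definition unit_at alpha X (t : {nonneg \bar R}) :
    hom (X t) (X (translation_ext alpha t)) :=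
  fmap X (translation_ext_ge alpha t
          : hom (t : extnonneg_category R) (translation_ext alpha t)).

Definition interleaving alpha X Y (G : nattrans X Y) : Prop :=
  forall t : {nonneg \bar R},
    exists F : hom (Y t) (X (translation_ext alpha t)),
      unit_at alpha X t = comp F (G t) /\
      unit_at alpha Y t = comp (G (translation_ext alpha t)) F.

End interleaving.

(** * The homotopy category of topological spaces *)

Lemma continuous_pairf (Z X Y : topologicalType) (f : Z -> X) (g : Z -> Y) :
  continuous f -> continuous g -> continuous (fun z => (f z, g z)).
Proof.
move=> cf cg z.
by apply: (@cvg_pair _ _ _ (nbhs z) (nbhs (f z)) (nbhs (g z)));
  [exact: cf|exact: cg].
Qed.

Lemma within_comp (Z X Y : topologicalType) (A : set Z) (B : set X)
    (H : X -> Y) (u : Z -> X) :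
  {within B, continuous H} -> continuous u ->
  (forall z, A z -> B (u z)) -> {within A, continuous (H \o u)}.
Proof.
move=> /continuousP cH /continuousP cu AB; apply/continuousP => O oO.
have /open_subspaceP[V oV VE] := cH _ oO.
apply/open_subspaceP; exists (u @^-1` V); first exact: cu.
rewrite eqEsubset; split=> z [/= P Az]; split=> //.
- have : (V `&` B) (u z) by split=> //; exact: AB.
  by rewrite VE => -[].
- have : (H @^-1` O `&` B) (u z) by split=> //; exact: AB.
  by rewrite -VE => -[].
Qed.

Section homotopy.
Context {R : realType} {X Y : topologicalType}.
Implicit Types f g h : continuousType X Y.

Definition cylinder : set (X * R) := [set p | p.2 \in `[0, 1]].

Definition homotopic f g : Prop := exists H : X * R -> Y,
  [/\ {within cylinder, continuous H},
      forall x, H (x, 0) = f x & forall x, H (x, 1) = g x].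

Lemma homotopic_refl f : homotopic f f.
Proof.
exists (f \o fst); split=> //.
apply: continuous_subspaceT => p; apply: continuous_comp; first exact: cvg_fst.
exact: cts_fun.
Qed.

Lemma homotopic_sym f g : homotopic f g -> homotopic g f.
Proof.
move=> [H [cH H0 H1]].
exists (H \o (fun p => (p.1, 1 - p.2))); split.
- apply: within_comp cH _ _.
    apply: continuous_pairf => p; first exact: cvg_fst.
    by apply: (@cvgB R R); [exact: cvg_cst|exact: cvg_snd].
  by move=> [x t]; rewrite /cylinder/= !in_itv/= subr_ge0 gerBl => /andP[-> ->].
- by move=> x /=; rewrite subr0.
- by move=> x /=; rewrite subrr.
Qed.

Lemma homotopic_trans g f h : homotopic f g -> homotopic g h -> homotopic f h.
Proof.
move=> [H [cH H0 H1]] [K [cK K0 K1]].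
pose u (p : X * R) := (p.1, 2 * p.2); pose v (p : X * R) := (p.1, 2 * p.2 - 1).
have cu : continuous u.
  apply: continuous_pairf => p; first exact: cvg_fst.
  by apply: (@cvgM R); [exact: cvg_cst|exact: cvg_snd].
have cv : continuous v.
  apply: continuous_pairf => p; first exact: cvg_fst.
  apply: (@cvgB R R); last exact: cvg_cst.
  by apply: (@cvgM R); [exact: cvg_cst|exact: cvg_snd].
pose M (p : X * R) := if p.2 <= 2^-1 then H (u p) else K (v p).
pose A : set (X * R) := snd @^-1` [set` `[0, 2^-1]].
pose B : set (X * R) := snd @^-1` [set` `[2^-1, 1]].
have clA : closed A.
  by apply: preimage_closed => [p _|]; [exact: cvg_snd|exact: itv_closed].
have clB : closed B.
  by apply: preimage_closed => [p _|]; [exact: cvg_snd|exact: itv_closed].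
have AB : cylinder = A `|` B.
  rewrite /cylinder /A /B; apply/seteqP; split=> -[x t] /=; rewrite !in_itv/=.
    by move=> /andP[t0 t1]; case: (leP t 2^-1) => ?; [left|right]; lra.
  by case; lra.
exists M; split.
- rewrite AB; apply: withinU_continuous => //.
    apply: (@subspace_eq_continuous _ _ _ (H \o u)).
      move=> [x t]; rewrite inE /A/= in_itv/= => /andP[_ t1].
      by rewrite /M /from_subspace /= ifT.
    apply: within_comp cH cu _ => -[x t].
    by rewrite /A /cylinder/= !in_itv/=; lra.
  apply: (@subspace_eq_continuous _ _ _ (K \o v)).
    move=> [x t]; rewrite inE /B/= in_itv/= => /andP[t1 _].
    rewrite /M /from_subspace /=.
    case: ifPn => // t2; have -> : t = 2^-1 by lra.
    by rewrite /u /v/= divff// subrr H1 K0.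
  apply: within_comp cK cv _ => -[x t].
  by rewrite /B /cylinder/= !in_itv/=; lra.
- by move=> x; rewrite /M/= invr_ge0 ler0n /u/= mulr0.
- move=> x; rewrite /M/= ifF; last by apply/negbTE; lra.
  by rewrite /v/= (_ : 2 * 1 - 1 = 1 :> R)//; lra.
Qed.

End homotopy.

Section homotopy_comp.
Context {R : realType} {X Y Z : topologicalType}.

Lemma homotopic_comp (f f' : continuousType X Y) (g g' : continuousType Y Z) :
  homotopic (R := R) f f' -> homotopic (R := R) g g' ->
  homotopic (R := R) (g \o f : continuousType X Z) (g' \o f').
Proof.
move=> [H [cH H0 H1]] [K [cK K0 K1]].
apply: (@homotopic_trans _ _ _ (g \o f' : continuousType X Z)).
  exists (g \o H); split=> [|x /=|x /=]; rewrite ?H0 ?H1//.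
  move/continuousP: cH => cH; apply/continuousP => O oO.
  rewrite -[_ @^-1` _]/(from_subspace cylinder H @^-1` (g @^-1` O)); apply: cH.
  by have /continuousP := @cts_fun _ _ g; exact.
exists (K \o (fun p => (f' p.1, p.2))); split=> [|x /=|x /=]//.
apply: within_comp cK _ _ => //.
apply: continuous_pairf => p; last exact: cvg_snd.
by apply: continuous_comp; [exact: cvg_fst|exact: cts_fun].
Qed.

End homotopy_comp.

Section homotopy_category.
Variable R : realType.
Implicit Types X Y Z : topologicalType.

Definition homotopicb X Y : rel (continuousType X Y) :=
  fun f g => `[< homotopic (R := R) f g >].

Fact homotopicb_refl X Y : reflexive (@homotopicb X Y).
Proof. by move=> f; apply/asboolP; exact: homotopic_refl. Qed.

Fact homotopicb_sym X Y : symmetric (@homotopicb X Y).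
Proof. by move=> f g; apply/asboolP/asboolP; exact: homotopic_sym. Qed.

Fact homotopicb_trans X Y : transitive (@homotopicb X Y).
Proof.
move=> g f h /asboolP fg /asboolP gh; apply/asboolP.
exact: homotopic_trans gh.
Qed.

Canonical homotopic_equiv X Y := EquivRel (@homotopicb X Y)
  (@homotopicb_refl X Y) (@homotopicb_sym X Y) (@homotopicb_trans X Y).

Definition homotopy_class X Y := {eq_quot homotopic_equiv X Y}.

Definition hclass X Y (f : continuousType X Y) : homotopy_class X Y :=
  \pi_(homotopy_class X Y) f.

Lemma hclassP X Y (f g : continuousType X Y) :
  hclass f = hclass g <-> homotopic (R := R) f g.
Proof.
split=> [/eqP|fg]; first by rewrite /hclass eqmodE => /asboolP.
by apply/eqP; rewrite /hclass eqmodE; apply/asboolP.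
Qed.

Definition hcomp X Y Z (b : homotopy_class Y Z) (a : homotopy_class X Y) :
  homotopy_class X Z := hclass (repr b \o repr a).

Lemma hcompE X Y Z (g : continuousType Y Z) (f : continuousType X Y) :
  hcomp (hclass g) (hclass f) = hclass (g \o f).
Proof.
by apply/hclassP/homotopic_comp; apply/hclassP; rewrite /hclass reprK.
Qed.

Lemma hclass_ind X Y (P : homotopy_class X Y -> Prop) :
  (forall f, P (hclass f)) -> forall a, P a.
Proof. by move=> Pf a; rewrite -[a]reprK; exact: Pf. Qed.

Fact hcomp1m X Y (a : homotopy_class X Y) : hcomp (hclass (@idfun Y)) a = a.
Proof.
elim/hclass_ind: a => f; rewrite hcompE; congr hclass; exact/continuousEP.
Qed.

Fact hcompm1 X Y (a : homotopy_class X Y) : hcomp a (hclass (@idfun X)) = a.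
Proof.
elim/hclass_ind: a => f; rewrite hcompE; congr hclass; exact/continuousEP.
Qed.

Fact hcompA X Y Z T (c : homotopy_class Z T) (b : homotopy_class Y Z)
    (a : homotopy_class X Y) : hcomp c (hcomp b a) = hcomp (hcomp c b) a.
Proof.
elim/hclass_ind: c => h; elim/hclass_ind: b => g; elim/hclass_ind: a => f.
by rewrite !hcompE; congr hclass; exact/continuousEP.
Qed.

Definition homotopy_category : category :=
  @Category topologicalType homotopy_class (fun X => hclass (@idfun X))
    hcomp hcomp1m hcompm1 hcompA.

End homotopy_category.

(** * Simplicial complexes and geometric realization *)

(* A complex on V need not have all elements of V as vertices. *)
Record simplicial_complex (V : Type) := SimplicialComplex {
  simplex : set (set V);
  simplex_finite : forall s, simplex s -> finite_set s;
  simplex_sub : forall s t, simplex s -> t `<=` s -> simplex t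
}.

Definition complex_category (V : Type) : category :=
  @thin_category (simplicial_complex V) (fun K K' => simplex K `<=` simplex K')
    (fun K => @subset_refl _ (simplex K))
    (fun K' K K'' => @subset_trans _ (simplex K') (simplex K) (simplex K'')).

Section realization.
Variables (R : realType) (V : Type).
Implicit Types (K : simplicial_complex V) (s : set V).

Record realization K := Realization {
  bary :> V -> R;
  bary_ge0 : forall v, 0 <= bary v;
  (* a finite sum by bary_supp; {classic V} is V with a choice structure *)
  bary_sum : \sum_(v \in [set: {classic V}]) bary v = 1;
  bary_supp : simplex K [set v | bary v != 0]
}.

Lemma realization_eq K (x y : realization K) : bary x =1 bary y -> x = y.
Proof.
case: x y => [x x0 x1 xK] [y y0 y1 yK] /= /funext xy.
by subst y; congr Realization; exact: Prop_irrelevance.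
Qed.

HB.instance Definition _ K := gen_eqMixin (realization K).
HB.instance Definition _ K := gen_choiceMixin (realization K).

Definition in_simplex K s (x : realization K) := [set v | x v != 0] `<=` s.

(* U is open iff its trace on every closed simplex is open, a closed simplex
   carrying the Euclidean topology of its barycentric coordinates *)
Definition realization_open K : set_system (realization K) :=
  [set U | forall s, simplex K s -> forall x, in_simplex s x -> U x ->
    exists2 e : R, 0 < e & forall y : realization K, in_simplex s y ->
      (forall v, s v -> `|x v - y v| < e) -> U y].

Fact realization_openT K : @realization_open K setT.
Proof. by move=> s _ x _ _; exists 1. Qed.

Fact realization_openI K : setI_closed (@realization_open K).
Proof.
move=> A B oA oB s Ks x sx [Ax Bx].
have [e e0 Ae] := oA s Ks x sx Ax; have [d d0 Bd] := oB s Ks x sx Bx.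
exists (Num.min e d); first by rewrite lt_min e0.
by move=> y sy xy; split; [apply: Ae|apply: Bd] => // v /xy;
  rewrite lt_min => /andP[].
Qed.

Fact realization_open_bigU K (I : Type) (f : I -> set (realization K)) :
  (forall i, realization_open (f i)) -> realization_open (\bigcup_i f i).
Proof.
move=> of_ s Ks x sx [i _ fx]; have [e e0 fe] := of_ i s Ks x sx fx.
by exists e => // y sy xy; exists i => //; exact: fe.
Qed.

HB.instance Definition _ K := isOpenTopological.Build (realization K)
  (@realization_openT K) (@realization_openI K) (@realization_open_bigU K).

Lemma realization_openE K : @open (realization K) = @realization_open K.
Proof. by []. Qed.

Section inclusion.
Variables (K K' : simplicial_complex V) (KK' : simplex K `<=` simplex K').

Definition realization_incl (x : realization K) : realization K' :=
  @Realization K' x (bary_ge0 x) (bary_sum x) (KK' (bary_supp x)).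

Fact realization_incl_continuous : continuous realization_incl.
Proof.
apply/continuousP => U; rewrite !realization_openE => oU s Ks x sx Ux.
have [e e0 Ue] := oU s (KK' Ks) (realization_incl x) sx Ux.
by exists e => // y sy xy; exact: Ue.
Qed.

HB.instance Definition _ := isContinuous.Build _ _ realization_incl
  realization_incl_continuous.

End inclusion.

Fact realization_incl_id K (KK : simplex K `<=` simplex K) :
  hclass R (realization_incl KK) = hclass R (@idfun (realization K)).
Proof.
by congr hclass; apply/continuousEP => x; exact: realization_eq.
Qed.

Fact realization_incl_comp K K' K'' (g : simplex K' `<=` simplex K'')
    (f : simplex K `<=` simplex K') (h : simplex K `<=` simplex K'') :
  hclass R (realization_incl h) =
  hcomp (hclass R (realization_incl g)) (hclass R (realization_incl f)).
Proof.
by rewrite hcompE; congr hclass; apply/continuousEP => x; exact: realization_eq.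
Qed.

Definition realization_functor :
    functor (complex_category V) (homotopy_category R) :=
  @Functor (complex_category V) (homotopy_category R)
    (fun K => realization K : topologicalType)
    (fun K K' f => hclass R (realization_incl f))
    (fun K => realization_incl_id _)
    (fun K K' K'' g f => realization_incl_comp g f _).

End realization.

(** * Dissimilarities, Dowker nerves, truncations *)

Definition dissimilarity (R : realType) (L W : Type) :=
  L -> W -> {nonneg \bar R}.

Section dowker.
Context {R : realType} {L W : Type}.
Implicit Types (Lambda : dissimilarity R L W) (T : L -> {nonneg \bar R}).
Implicit Types (s t : {nonneg \bar R}).

Definition nerve_simplex Lambda t : set (set L) :=
  [set sigma | finite_set sigma /\
    exists w, forall l, sigma l -> (Lambda l w < t)%O].

Fact nerve_finite Lambda t sigma :
  nerve_simplex Lambda t sigma -> finite_set sigma.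
Proof. by case. Qed.

Fact nerve_sub Lambda t sigma tau :
  nerve_simplex Lambda t sigma -> tau `<=` sigma -> nerve_simplex Lambda t tau.
Proof.
move=> [fs [w sw]] ts; split; first exact: sub_finite_set fs.
by exists w => l /ts; exact: sw.
Qed.

Definition nerve_complex Lambda t : simplicial_complex L :=
  SimplicialComplex (@nerve_finite Lambda t) (@nerve_sub Lambda t).

Fact nerve_homo Lambda s t : (s <= t)%O ->
  simplex (nerve_complex Lambda s) `<=` simplex (nerve_complex Lambda t).
Proof.
move=> st sigma [fs [w sw]]; split=> //.
by exists w => l /sw /lt_le_trans; exact.
Qed.

Definition nerve Lambda : filtered R (complex_category L) :=
  @Functor (extnonneg_category R) (complex_category L) (nerve_complex Lambda)
    (@nerve_homo Lambda) (fun _ => thin_irrelevance _ _)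
    (fun _ _ _ _ _ => thin_irrelevance _ _).

Definition realized_nerve Lambda : filtered R (homotopy_category R) :=
  comp_functor (realization_functor R L) (nerve Lambda).

Definition truncation_function (alpha : translation R) Lambda T : Prop :=
  forall t l, exists l', forall w, (Lambda l w < t)%O ->
    (Lambda l' w < translation_ext alpha t)%O /\ (Lambda l' w < T l')%O.

Definition truncation Lambda T : dissimilarity R L W := fun l w =>
  if (Lambda l w < T l)%O then Lambda l w else (+oo%:nng)%E.

Fact truncation_nerve_sub Lambda T t :
  simplex (nerve_complex (truncation Lambda T) t) `<=`
  simplex (nerve_complex Lambda t).
Proof.
move=> sigma [fs [w sw]]; split=> //; exists w => l /sw.
rewrite /truncation; case: ifP => // _.
rewrite -[(_ < _)%O]/((+oo < t%:num)%E).
by rewrite ltNge leey.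
Qed.

Definition truncation_incl Lambda T :
    nattrans (nerve (truncation Lambda T)) (nerve Lambda) :=
  @NatTrans (extnonneg_category R) (complex_category L)
    (nerve (truncation Lambda T)) (nerve Lambda)
    (@truncation_nerve_sub Lambda T) (fun _ _ _ => thin_irrelevance _ _).

Definition realized_truncation_incl Lambda T :
    nattrans (realized_nerve (truncation Lambda T)) (realized_nerve Lambda) :=
  whisker (realization_functor R L) (truncation_incl Lambda T).

End dowker.

(* Main.v *)
From HB Require Import structures.
Require Import Defs.
From mathcomp Require Import all_boot all_order all_algebra.
From mathcomp Require Import finmap all_classical all_reals interval_inference.
From mathcomp Require Import topology normedtype ring lra.

Set Implicit Arguments.
Unset Strict Implicit.
Unset Printing Implicit Defensive.
Import Order.TTheory GRing.Theory Num.Theory.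
Import numFieldNormedType.Exports.
Local Open Scope classical_set_scope.
Local Open Scope ring_scope.

(** Fix [t] and let [u] be the value of the translation at [t].  The truncation
hypothesis provides a map [f : L -> L], sending [l] to [l'], such that every
witness of [l] below [t] for [Lambda] is a witness of [f l] below [u] for the
truncation [Gamma].  Hence a witness of a simplex [s] of the nerve of [Lambda]
at [t] is also a witness of [f @` s], in the nerve of [Gamma] at [u], and [f]
is simplicial between these two complexes; its realization is the backward
morphism of the interleaving.

Both interleaving equations compare an inclusion with a map induced by [f],
once for [Gamma] and once for [Lambda].  In each case the same witness serves
[s] and [f @` s] simultaneously, so that [s `|` f @` s] is a simplex at [u]
([nerve_shift_contiguous]): the two simplicial maps are contiguous.  Contiguous
maps have homotopic realizations ([contiguous_homotopic]), by the straight line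
homotopy in barycentric coordinates.

The only delicate point is the continuity of that homotopy: the cylinder has
the product topology, whereas estimates are available only on products of a
closed simplex with the line.  They suffice because the line is locally compact
([cylinder_continuous]). *)

(** * The cylinder over a realization *)

Section tube.
Variables (R : realType) (V : Type) (K : simplicial_complex V).
Variables (Y : topologicalType) (H : realization R K * R -> Y).

(* H is continuous on the product of each closed simplex with the line, in
   epsilon form. *)
Hypothesis H_simplex : forall s O, simplex K s -> open O ->
  forall x t, in_simplex s x -> O (H (x, t)) ->
  exists2 d : R, 0 < d & forall (y : realization R K) t', in_simplex s y ->
    (forall v, s v -> `|x v - y v| < d) -> `|t - t'| < d -> O (H (y, t')).

(** Openness in a realization is tested on one closed simplex at a time; there
it is the tube lemma for the compact interval [[a, b]], which turns the radii
given by [H_simplex] at each time into a single one. *)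
Lemma open_tube (O : set Y) (a b : R) : open O ->
  open [set x : realization R K | forall t, t \in `[a, b] -> O (H (x, t))].
Proof.
move=> oO; rewrite realization_openE => s Ks x sx xO.
have /compact_near_coveringP cpt := @segment_compact R a b.
pose P (d t : R) := forall y : realization R K, in_simplex s y ->
  (forall v, s v -> `|x v - y v| < d) -> O (H (y, t)).
have abP : \forall d \near 0^'+, `[a, b] `<=` P d.
  apply: cpt => t abt.
  have [e e0 eO] := H_simplex Ks oO sx (xO t abt).
  exists (ball t e, [set d | d < e]) => /=.
    by split; [exact: nbhsx_ballx|exact: nbhs_right_lt].
  move=> [t' d] /= [tt' de] y sy xy; apply: eO => // v sv.
  exact: lt_trans (xy v sv) de.
have [d [d0 dP]] := filter_ex (filterI (nbhs_right_gt 0) abP).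
exists d => // y sy xy t abt; exact: dP abt y sy xy.
Qed.

(** The product topology on the cylinder is coherent with the closed simplices.
A neighbourhood of [(x, t)] inside the preimage of [O] is the product of a
short interval around [t] with the open set of all points whose whole path
over the closure of that interval stays in [O]. *)
Lemma cylinder_continuous : continuous H.
Proof.
apply/continuousP => O oO; rewrite openE => -[x t] /= Oxt.
have sx : in_simplex [set v | x v != 0] x by [].
have [d d0 dO] := H_simplex (bary_supp x) oO sx Oxt.
(* The closed interval must lie in the open one of radius d around t. *)
pose a := t - d / 2; pose b := t + d / 2.
exists ([set y | forall t', t' \in `[a, b] -> O (H (y, t'))],
  `]a, b[%classic) => /=.
  split.
    apply: open_nbhs_nbhs; split; first exact: open_tube.
    move=> t'; rewrite in_itv/= => tt'; apply: dO => // [v _|].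
      by rewrite subrr normr0.
    by rewrite ltr_norml; move: tt'; rewrite /a /b; lra.
  by apply: near_in_itvoo; rewrite in_itv/= /a /b; lra.
by move=> [y t'] /= [yO /subset_itv_oo_cc]; exact: yO.
Qed.

End tube.

(** * Simplicial and contiguous maps *)

Lemma bary_sum_simplex (R : realType) (V : Type) (K : simplicial_complex V)
    (s : set V) (x : realization R K) : in_simplex s x ->
  \sum_(v \in (s : set {classic V})) x v = 1.
Proof.
move=> sx; rewrite -(bary_sum x); apply: fsbig_widen => // v [_ /= sv].
by apply/eqP/negPn/negP => /sx.
Qed.

Lemma bary_le1 (R : realType) (V : Type) (K : simplicial_complex V)
    (x : realization R K) v : x v <= 1.
Proof.
have [->//|xv] := eqVneq (x v) 0.
pose s : set {classic V} := [set v | x v != 0].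
have fs : finite_set s := simplex_finite (bary_supp x).
rewrite -(bary_sum_simplex (s := s) (x := x))// (fsbigD1 (v : {classic V}))//.
by rewrite lerDl fsumr_ge0// => u _; exact: bary_ge0.
Qed.

Definition simplicial (V V' : Type) (K : simplicial_complex V)
    (K' : simplicial_complex V') (f : V -> V') :=
  forall s, simplex K s -> simplex K' (f @` s).

Definition contiguous (V V' : Type) (K : simplicial_complex V)
    (K' : simplicial_complex V') (f g : V -> V') :=
  forall s, simplex K s -> simplex K' (f @` s `|` g @` s).

Section pushforward.
Variables (R : realType) (V V' : Type).

(** The affine extension of [f] in barycentric coordinates. *)
Definition push_bary (f : V -> V') (x : V -> R) (v : V') : R :=
  \sum_(u \in [set: {classic V}]) x u * (`[< f u = v >])%:R.

Variables (K : simplicial_complex V) (f : V -> V').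
Implicit Types (s : set V) (x y : realization R K).

Lemma push_bary_simplex s x v : in_simplex s x ->
  push_bary f x v =
  \sum_(u \in (s : set {classic V})) x u * (`[< f u = v >])%:R.
Proof.
move=> sx; apply/esym/fsbig_widen => // u [_ /= su].
have -> : x u = 0 by apply/eqP/negPn/negP => /sx.
by rewrite mul0r.
Qed.

Lemma push_bary_ge0 x v : 0 <= push_bary f x v.
Proof. by apply: fsumr_ge0 => u _; rewrite mulr_ge0// bary_ge0. Qed.

Lemma push_bary_supp s x v : in_simplex s x ->
  push_bary f x v != 0 -> (f @` s) v.
Proof.
move=> sx; apply: contra_neqP => sv; rewrite (push_bary_simplex _ sx).
apply: fsbig1 => u su; case: asboolP => [fuv|_]; last by rewrite mulr0.
by case: sv; exists u.
Qed.

Lemma push_bary_sum x : \sum_(v \in [set: {classic V'}]) push_bary f x v = 1.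
Proof.
pose s : set {classic V} := [set v | x v != 0].
have fs : finite_set s := simplex_finite (bary_supp x).
have sx : in_simplex s x by [].
pose fS : set {classic V'} := f @` s.
have ffS : finite_set fS by exact: finite_image.
transitivity (\sum_(v \in fS) push_bary f x v).
  apply/esym/fsbig_widen => //.
  by move=> v [_ /= sv]; apply/eqP/negPn/negP => /(push_bary_supp sx).
under eq_fsbigr do rewrite (push_bary_simplex _ sx).
rewrite exchange_fsbig// -[RHS](bary_sum_simplex sx); apply: eq_fsbigr => u.
rewrite inE => su.
rewrite (fsbigD1 (f u : {classic V'}))//=; last by exists u.
rewrite asboolT//= mulr1 fsbig1 ?addr0// => v [_ /= /eqP vfu].
by case: asboolP => [fuv|_]; [rewrite fuv eqxx in vfu|rewrite mulr0].
Qed.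

(** A coordinate of the image is a sum of at most [#|s|] coordinates of the
point, hence a bound that does not depend on the coordinate [v]. *)
Lemma push_bary_equicontinuous s (e : R) : finite_set s -> 0 < e ->
  exists2 d : R, 0 < d & forall x y, in_simplex s x -> in_simplex s y ->
    (forall u, s u -> `|x u - y u| < d) ->
    forall v, `|push_bary f x v - push_bary f y v| < e.
Proof.
move=> fs e0; pose r : {fset {classic V}} := fset_set (s : set {classic V}).
pose n : R := (#|` r|)%:R.
have n0 : 0 < n + 1 by rewrite ltr_wpDl.
(* n + 1 rather than n: s may be empty. *)
exists (e / (n + 1)) => [|x y sx sy xy v]; first exact: divr_gt0.
apply: (@le_lt_trans _ _ (n * (e / (n + 1)))); last first.
  by rewrite mulrCA gtr_pMr// ltr_pdivrMr// mul1r ltrDl.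
rewrite (push_bary_simplex _ sx) (push_bary_simplex _ sy) !fsbig_finite//.
rewrite -sumrB (le_trans (ler_norm_sum _ _ _))//.
have -> : n * (e / (n + 1)) = \sum_(u <- r) e / (n + 1).
  by rewrite big_const_seq iter_addr_0 count_predT mulr_natl.
rewrite [leLHS]big_seq [leRHS]big_seq; apply: ler_sum => u.
rewrite in_fset_set// inE => su; rewrite -mulrBl normrM normr_nat.
case: asboolP => _; rewrite ?mulr1 ?mulr0; first exact/ltW/xy.
by rewrite divr_ge0// ltW.
Qed.

End pushforward.

Definition simplicial_realization (R : realType) (V V' : Type)
    (K : simplicial_complex V) (K' : simplicial_complex V') (f : V -> V')
    (fK : simplicial K K' f) (x : realization R K) : realization R K' :=
  @Realization R V' K' (push_bary f x) (push_bary_ge0 f x) (push_bary_sum f x)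
    (simplex_sub (fK _ (bary_supp x))
      (fun v => @push_bary_supp R V V' K f _ x v (fun _ => id))).
Arguments simplicial_realization R {V V' K K' f} fK x.

(** * The straight line homotopy *)

(** Homotopies are functions on the whole line; composing the time parameter
with the retraction of the line onto the unit interval makes the straight line
homotopy defined, and even continuous, at all times. *)
Definition clamp (R : realType) (t : R) : R := Num.max 0 (Num.min t 1).

Lemma clamp_itv (R : realType) (t : R) : 0 <= clamp t <= 1.
Proof. by rewrite /clamp le_max lexx ge_max ler01 ge_min lexx orbT. Qed.

Lemma clamp_lipschitz (R : realType) (t t' : R) :
  `|clamp t - clamp t'| <= `|t - t'|.
Proof.
have := ler_norm (t - t'); have := ler_norm (t' - t); rewrite distrC ler_norml.
rewrite /clamp; case: (leP t 1) => ?; case: (leP t' 1) => ?.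
- by case: (leP 0 t) => ?; case: (leP 0 t') => ?; lra.
- by rewrite (max_r ler01); case: (leP 0 t) => ?; lra.
- by rewrite (max_r ler01); case: (leP 0 t') => ?; lra.
- by rewrite subrr; lra.
Qed.

Section segment.
Variables (R : realType) (V : Type) (K : simplicial_complex V).
Variables (a b : realization R K) (c : R).
Hypotheses (c01 : 0 <= c <= 1)
  (abK : simplex K ([set v | a v != 0] `|` [set v | b v != 0])).

Definition segment_bary v := (1 - c) * a v + c * b v.

Lemma segment_bary_ge0 v : 0 <= segment_bary v.
Proof.
case/andP: c01 => c0 c1.
by rewrite addr_ge0// mulr_ge0 ?bary_ge0// subr_ge0.
Qed.

Lemma segment_bary_supp :
  [set v | segment_bary v != 0] `<=` [set v | a v != 0] `|` [set v | b v != 0].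
Proof.
move=> v /=; rewrite /segment_bary.
have [->|av] := eqVneq (a v) 0; last by left.
by have [->|bv] := eqVneq (b v) 0; [rewrite !mulr0 addr0 eqxx|right].
Qed.

Lemma segment_bary_sum :
  \sum_(v \in [set: {classic V}]) segment_bary v = 1.
Proof.
pose s : set {classic V} := [set v | a v != 0] `|` [set v | b v != 0].
have fs : finite_set s := simplex_finite abK.
transitivity (\sum_(v \in s) segment_bary v).
  apply/esym/fsbig_widen => //.
  by move=> v [_ /= sv]; apply/eqP/negPn/negP => /segment_bary_supp.
rewrite fsbig_split// -!mulr_fsumr.
by rewrite /= !bary_sum_simplex ?mulr1 ?subrK// => v ?; [right|left].
Qed.

Definition segment_point : realization R K :=
  Realization segment_bary_ge0 segment_bary_sum
    (simplex_sub abK segment_bary_supp).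

End segment.

Section contiguity.
Variables (R : realType) (V V' : Type).
Variables (K : simplicial_complex V) (K' : simplicial_complex V').
Variables (f g : V -> V').
Hypothesis fgK : contiguous K K' f g.

Lemma contiguous_simpliciall : simplicial K K' f.
Proof. by move=> s /fgK/simplex_sub; apply; left. Qed.

Lemma contiguous_simplicialr : simplicial K K' g.
Proof. by move=> s /fgK/simplex_sub; apply; right. Qed.

Let fx := simplicial_realization R contiguous_simpliciall.
Let gx := simplicial_realization R contiguous_simplicialr.

Lemma contiguous_supp s x : in_simplex s x ->
  [set v | fx x v != 0] `|` [set v | gx x v != 0] `<=` f @` s `|` g @` s.
Proof. by move=> sx v [|] /(push_bary_supp sx); [left|right]. Qed.

Lemma contiguous_simplex x :
  simplex K' ([set v | fx x v != 0] `|` [set v | gx x v != 0]).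
Proof. exact: simplex_sub (fgK (bary_supp x)) (contiguous_supp _). Qed.

Definition contiguity_homotopy (p : realization R K * R) : realization R K' :=
  segment_point (clamp_itv p.2) (contiguous_simplex p.1).

(** Over a simplex [s], the homotopy takes values in the single simplex
[f @` s `|` g @` s], so that an open set is entered at a uniform coordinatewise
distance; each coordinate varies by at most a convex combination of the
variations of the two ends, plus the variation of the time parameter. *)
Lemma contiguity_homotopy_continuous : continuous contiguity_homotopy.
Proof.
apply: cylinder_continuous => s O Ks oO x t sx.
have Hs y t' : in_simplex s y ->
    in_simplex (f @` s `|` g @` s) (contiguity_homotopy (y, t')).
  move=> sy; apply: subset_trans (contiguous_supp sy).
  exact: segment_bary_supp.
move=> /(oO _ (fgK Ks) _ (Hs x t sx))[e e0 eO].
have e30 : 0 < e / 3 by lra.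
have fs := simplex_finite Ks.
have [d d0 df] := push_bary_equicontinuous K f fs e30.
have [d' d'0 dg] := push_bary_equicontinuous K g fs e30.
exists (Num.min (Num.min d d') (e / 3)); first by rewrite !lt_min d0 d'0.
move=> y t' sy xy; rewrite !lt_min => /andP[_ tt'].
apply: eO (Hs y t' sy) _ => v _.
have {}df : `|fx x v - fx y v| < e / 3.
  by apply: df => // u /xy; rewrite !lt_min => /andP[/andP[]].
have {}dg : `|gx x v - gx y v| < e / 3.
  by apply: dg => // u /xy; rewrite !lt_min => /andP[/andP[]].
have {tt'} : `|clamp t - clamp t'| < e / 3.
  exact: le_lt_trans (clamp_lipschitz t t') tt'.
rewrite /= /segment_bary.
move: (clamp t) (clamp t') (clamp_itv t') => c c' /andP[c'0 c'1] cc'.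
(* The last term vanishes at equal times; the others form a convex combination
   of the variations of the two ends. *)
have -> : (1 - c) * fx x v + c * gx x v - ((1 - c') * fx y v + c' * gx y v) =
  (1 - c') * (fx x v - fx y v) + c' * (gx x v - gx y v) +
  (c - c') * (gx x v - fx x v) by ring.
have D1 : `|gx x v - fx x v| <= 1.
  have := bary_le1 (fx x) v; have := bary_le1 (gx x) v.
  have := bary_ge0 (fx x) v; have := bary_ge0 (gx x) v.
  by rewrite ler_norml; lra.
suff : `|(1 - c') * (fx x v - fx y v) + c' * (gx x v - gx y v)| +
       `|(c - c') * (gx x v - fx x v)| <= e / 3 + e / 3.
  by move=> le_e; apply: le_lt_trans (ler_normD _ _) _; lra.
apply: lerD; last by rewrite normrM -[leRHS]mulr1 ler_pM// ltW.
have -> : e / 3 = (1 - c') * (e / 3) + c' * (e / 3) by ring.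
apply: le_trans (ler_normD _ _) _; rewrite !normrM (ger0_norm c'0).
have c'1' : 0 <= 1 - c' by rewrite subr_ge0.
by rewrite (ger0_norm c'1') lerD// ler_wpM2l// ltW.
Qed.

Lemma contiguity_homotopy0 x : contiguity_homotopy (x, 0) = fx x.
Proof.
apply: realization_eq => v; rewrite /= /segment_bary /clamp /=.
by rewrite min_l// maxxx subr0 mul1r mul0r addr0.
Qed.

Lemma contiguity_homotopy1 x : contiguity_homotopy (x, 1) = gx x.
Proof.
apply: realization_eq => v; rewrite /= /segment_bary /clamp /=.
by rewrite minxx max_r// subrr mul0r mul1r add0r.
Qed.

End contiguity.

Section simplicial_realization_continuous.
Variables (R : realType) (V V' : Type).
Variables (K : simplicial_complex V) (K' : simplicial_complex V').
Variables (f : V -> V') (fK : simplicial K K' f).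

Lemma simplicial_contiguous : contiguous K K' f f.
Proof. by move=> s Ks; rewrite setUid; exact: fK. Qed.

(** A simplicial map is contiguous to itself, and its realization is the initial
stage of the homotopy thus obtained; so its continuity needs no estimate of its
own. *)
Lemma simplicial_realization_continuous :
  continuous (simplicial_realization R fK).
Proof.
have -> : simplicial_realization R fK =
    contiguity_homotopy simplicial_contiguous \o
    (fun x : realization R K => (x, 0)).
  apply/funext => x /=; rewrite contiguity_homotopy0.
  by apply: realization_eq => v.
move=> x; apply: continuous_comp; last exact: contiguity_homotopy_continuous.
by apply: continuous_pairf => y; [exact: cvg_id|exact: cst_continuous].
Qed.

HB.instance Definition _ := isContinuous.Build _ _
  (simplicial_realization R fK) simplicial_realization_continuous.

End simplicial_realization_continuous.

Lemma contiguous_homotopic (R : realType) (V V' : Type)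
    (K : simplicial_complex V) (K' : simplicial_complex V') (f g : V -> V')
    (fK : simplicial K K' f) (gK : simplicial K K' g) :
  contiguous K K' f g ->
  homotopic (R := R) (simplicial_realization R fK)
    (simplicial_realization R gK).
Proof.
move=> fgK; exists (contiguity_homotopy fgK); split=> [|x|x].
- by apply: continuous_subspaceT; exact: contiguity_homotopy_continuous.
- by rewrite contiguity_homotopy0; apply: realization_eq => v.
- by rewrite contiguity_homotopy1; apply: realization_eq => v.
Qed.

Lemma push_bary_id (R : realType) (V : Type) (K : simplicial_complex V)
    (x : realization R K) v : push_bary id x v = x v.
Proof.
transitivity (\sum_(u \in [set (v : {classic V})]) x u * (`[< u = v >])%:R).
  apply/esym/fsbig_widen => // u [_ /= uv].
  by case: asboolP => // _; rewrite mulr0.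
by rewrite fsbig_set1 asboolT//= mulr1.
Qed.

(** An inclusion of complexes is the realization of the identity, so it may be
deformed along any simplicial map contiguous to the identity. *)
Lemma contiguous_incl_hclass (R : realType) (V : Type)
    (K K' : simplicial_complex V) (KK' : simplex K `<=` simplex K')
    (f : V -> V) (fK : simplicial K K' f) :
  (forall s, simplex K s -> simplex K' (s `|` f @` s)) ->
  hclass R (realization_incl KK') = hclass R (simplicial_realization R fK).
Proof.
move=> sfK.
have idK : simplicial K K' id by move=> s /KK'; rewrite image_id.
have -> : (realization_incl KK' : continuousType _ _) =
  (simplicial_realization R idK : continuousType _ _).
  apply/continuousEP => x; apply: realization_eq => v.
  by rewrite /= push_bary_id.
by apply/hclassP/contiguous_homotopic => s /sfK; rewrite image_id.
Qed.

(** * Shifting the nerve of a dissimilarity *)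

Section truncation.
Variables (R : realType) (L W : Type) (Lambda : dissimilarity R L W).
Variables (alpha : translation R) (T : L -> {nonneg \bar R}).
Implicit Types (t : {nonneg \bar R}) (l : L) (w : W).

Lemma truncation_lt t l w :
  (truncation Lambda T l w < t)%O -> (Lambda l w < t)%O.
Proof.
rewrite /truncation; case: ifP => // _.
by rewrite -[(_ < _)%O]/((+oo < t%:num)%E) ltNge leey.
Qed.

Variables (t : {nonneg \bar R}) (f : L -> L).
Let u := translation_ext alpha t.
Hypothesis fP : forall l w, (Lambda l w < t)%O ->
  (Lambda (f l) w < u)%O /\ (Lambda (f l) w < T (f l))%O.

Lemma truncation_shift l w :
  (Lambda l w < t)%O -> (truncation Lambda T (f l) w < u)%O.
Proof. by move=> /fP[fu fT]; rewrite /truncation fT. Qed.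

Lemma truncation_shift_simplicial :
  simplicial (nerve_complex Lambda t)
    (nerve_complex (truncation Lambda T) u) f.
Proof.
move=> s [fs [w sw]]; split; first exact: finite_image.
by exists w => _ [l sl <-]; exact/truncation_shift/sw.
Qed.

(** Stated for any dissimilarity because the two interleaving equations need it
for [Lambda] and for its truncation. *)
Lemma nerve_shift_contiguous (Gamma : dissimilarity R L W) :
  (forall l w, (Gamma l w < t)%O -> (Gamma (f l) w < u)%O) ->
  forall s, nerve_simplex Gamma t s -> nerve_simplex Gamma u (s `|` f @` s).
Proof.
move=> fG s [fs [w sw]]; split.
  by rewrite finite_setU; split=> //; exact: finite_image.
exists w => l [/sw/lt_le_trans|[k sk <-]]; last exact/fG/sw.
by apply; exact: translation_ext_ge.
Qed.

End truncation.

Theorem proposition4p3 (R : realType) (L W : Type)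
    (Lambda : dissimilarity R L W) (alpha : translation R)
    (T : L -> {nonneg \bar R}) (hT : truncation_function alpha Lambda T) :
  interleaving alpha (realized_truncation_incl Lambda T).
Proof.
move=> t; have [f fP] := choice (hT t).
exists (hclass R (simplicial_realization R (truncation_shift_simplicial fP))).
have fGamma l w : (truncation Lambda T l w < t)%O ->
    (truncation Lambda T (f l) w < translation_ext alpha t)%O.
  by move=> lw; exact: (truncation_shift fP (truncation_lt lw)).
have fLambda l w : (Lambda l w < t)%O ->
    (Lambda (f l) w < translation_ext alpha t)%O by move=> /fP[].
split; rewrite [RHS]hcompE.
- have fK : simplicial (nerve_complex (truncation Lambda T) t)
      (nerve_complex (truncation Lambda T) (translation_ext alpha t)) f.
    by move=> s /truncation_nerve_sub; exact: truncation_shift_simplicial.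
  rewrite [LHS](contiguous_incl_hclass _ _ fK); last first.
    exact: nerve_shift_contiguous fGamma.
  by congr hclass; apply/continuousEP => x; exact: realization_eq.
- have fK : simplicial (nerve_complex Lambda t)
      (nerve_complex Lambda (translation_ext alpha t)) f.
    by move=> s /(truncation_shift_simplicial fP)/truncation_nerve_sub.
  rewrite [LHS](contiguous_incl_hclass _ _ fK); last first.
    exact: nerve_shift_contiguous fLambda.
  by congr hclass; apply/continuousEP => x; exact: realization_eq.
Qed.
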